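(* Let $I \subseteq (0,\infty)$ be an interval with interior $I^{\circ}$, let $f : I^{\circ} \to (0,\infty)$ be twice differentiable on $I^{\circ}$, and let $a,b \in I^{\circ}$ with $a<b$ and $f'' \in L_1[a,b]$. Let $1<p<\infty$ and let $q$ satisfy $\frac1p+\frac1q=1$. Suppose that $|f''|^q$ is geometrically convex and monotonically decreasing on $[a,b]$. Let $x\in[a,b]$ be such that $|f''(x)|\neq|f''(a)|$ and $|f''(x)|\neq|f''(b)|$. Then $$\left| \frac{1}{b-a}\int_a^b f(u)\,du - f(x) + \left(x-\frac{a+b}{2}\right) f'(x)\right| \le \frac{1}{(2p+1)^{1/p}}\left\{ \frac{(x-a)^3}{2(b-a)}\Big[L\big(|f''(x)|^q,|f''(a)|^q\big)\Big]^{1/q} + \frac{(b-x)^3}{2(b-a)}\Big[L\big(|f''(x)|^q,|f''(b)|^q\big)\Big]^{1/q}\right\}.$$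
   Context: A function $g : J \to (0,\infty)$ on an interval $J\subset(0,\infty)$ is geometrically convex if $g(y^{t}z^{1-t}) \le [g(y)]^{t}[g(z)]^{1-t}$ for all $y,z\in J$ and $t\in[0,1]$; in particular its values are positive. ''Monotonically decreasing'' means non-increasing. For nonzero reals $u,v$ with $|u|\ne|v|$, the logarithmic mean is $L(u,v)=\dfrac{u-v}{\ln|u|-\ln|v|}$. *)

(* Defs.v *)
From mathcomp Require Import all_boot all_order all_algebra.
From mathcomp Require Import all_classical all_reals all_analysis.

Set Implicit Arguments.
Unset Strict Implicit.
Unset Printing Implicit Defensive.

Import Order.TTheory GRing.Theory Num.Theory.
Import numFieldNormedType.Exports.

Local Open Scope classical_set_scope.
Local Open Scope ring_scope.

(* g is a total function of which only the restriction to J matters. *)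
Definition geometrically_convex (R : realType) (J : set R) (g : R -> R) : Prop :=
  [/\ is_interval J,
      (forall y, J y -> 0 < y),
      (forall y, J y -> 0 < g y)
    & forall y z t, J y -> J z -> 0 <= t <= 1 ->
        g (y `^ t * z `^ (1 - t)) <= g y `^ t * g z `^ (1 - t)].

(* Meaningful only for u != 0, v != 0 and `|u| != `|v|; the value is 0 when
   `|u| = `|v|, not the usual continuous extension. *)
Definition log_mean (R : realType) (u v : R) : R :=
  (u - v) / (ln `|u| - ln `|v|).

(* Main.v *)
Require Import Defs.
From mathcomp Require Import all_boot all_order all_algebra.
From mathcomp Require Import all_classical all_reals all_analysis.
From mathcomp Require Import ring lra.
Import Order.TTheory GRing.Theory Num.Theory.
Import numFieldNormedType.Exports.
Local Open Scope ring_scope.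
Local Open Scope classical_set_scope.

(* For an antiderivative F of f and an endpoint c of [a, b], put
   W_c(y) = F y - F c - (y - c) f y + (y - c)^2 / 2 * f' y.  Then
   W_c' y = (y - c)^2 / 2 * f'' y, W_c c = 0, and (W_a x - W_b x) / (b - a) is
   the quantity to be bounded.  Monotonicity, AM-GM and geometric convexity give
   |f''(t x + (1 - t) c)|^q <= (|f'' x|^q)^t (|f'' c|^q)^(1 - t).
   Instead of integrating f'' and applying Hoelder's inequality, Young's
   inequality with the weights that make Hoelder's an equality bounds W_c'
   pointwise by the derivative of an explicit function, and the mean value
   theorem concludes. *)

(** * Preliminaries on exponents, segments and increments *)

Lemma conjugate_exponent_gt0 (R : realType) (p q : R) :
  1 < p -> p^-1 + q^-1 = 1 -> 0 < q.
Proof.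
move=> p1 pq; rewrite -invr_gt0.
have : p^-1 < 1 by rewrite invf_lt1//; lra.
by lra.
Qed.

Lemma convex_comb_itvcc (R : realType) (a b y z t : R) :
  y \in `[a, b]%R -> z \in `[a, b]%R -> t \in `[0, 1]%R ->
  t * y + (1 - t) * z \in `[a, b]%R.
Proof.
rewrite !in_itv/= => /andP[? ?] /andP[? ?] /andP[? ?].
by apply/andP; split; nra.
Qed.

(** The derivatives of [g + h] and [h - g] are nonnegative, so the mean value theorem applied to
    these two functions gives the two sides of the absolute value. This stands in for integrating
    the bound on [dg]. *)
Lemma norm_increment_le (R : realType) (a b : R) (g h dg dh : R -> R) :
  a <= b ->
  (forall t : R, t \in `]a, b[%R -> is_derive t 1 g (dg t)) ->
  (forall t : R, t \in `]a, b[%R -> is_derive t 1 h (dh t)) ->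
  (forall t : R, t \in `]a, b[%R -> `|dg t| <= dh t) ->
  {within `[a, b], continuous g} -> {within `[a, b], continuous h} ->
  `|g b - g a| <= h b - h a.
Proof.
move=> ab; move: (ab); rewrite le_eqVlt => /predU1P[<-|ltab].
  by rewrite !subrr normr0.
move=> gd hd le_d gc hc; rewrite ler_norml; apply/andP; split.
- have cgh : {within `[a, b], continuous (g + h)}.
    by move=> x; apply: continuousD; [exact: gc|exact: hc].
  have [t tab] := @MVT _ (g + h) (fun t => dg t + dh t) _ _ ltab
    (fun t tab => is_deriveD (gd t tab) (hd t tab)) cgh.
  rewrite fctE => E.
  suff : 0 <= g b + h b - (g a + h a) by lra.
  rewrite E mulr_ge0 ?subr_ge0//.
  by have := le_d _ tab; rewrite ler_norml => /andP[]; lra.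
- have cgh : {within `[a, b], continuous (h - g)}.
    by move=> x; apply: continuousD; [exact: hc|apply: continuousN; exact: gc].
  have [t tab] := @MVT _ (h - g) (fun t => dh t - dg t) _ _ ltab
    (fun t tab => is_deriveB (hd t tab) (gd t tab)) cgh.
  rewrite [X in X - _](_ : _ = h b - g b)// [X in _ - X](_ : _ = h a - g a)// => E.
  suff : 0 <= h b - g b - (h a - g a) by lra.
  rewrite E mulr_ge0 ?subr_ge0//.
  by have := le_d _ tab; rewrite ler_norml => /andP[]; lra.
Qed.

(** * The logarithmic mean bound for increments over [0, 1] *)

Lemma log_mean_gt0 (R : realType) (u v : R) :
  0 < u -> 0 < v -> u != v -> 0 < log_mean u v.
Proof.
move=> u0 v0; rewrite neq_lt /log_mean !gtr0_norm// => /orP[uv|vu].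
- by rewrite -mulrNN -invrN !opprB divr_gt0// subr_gt0// ltr_ln.
- by rewrite divr_gt0// subr_gt0// ltr_ln.
Qed.

Lemma powR_within_continuous01 (R : realType) (r : R) : 0 < r ->
  {within `[0, 1], continuous (fun t : R => t `^ r)}.
Proof.
move=> r0; apply: derivable_oo_LRcontinuous_within; split.
- move=> t; rewrite in_itv/= => /andP[t0 _].
  by have [] := is_derive1_powR r t0.
- by rewrite powR0 ?gt_eqF//; exact: powR_cvg0.
- apply: cvg_at_left_filter.
  by have [/derivable1_diffP/differentiable_continuous] := @is_derive1_powR R r 1 ltr01.
Qed.

Lemma norm_increment_le_log_mean (R : realType) (p q al be C : R)
    (w dw k : R -> R) :
  1 < p -> p^-1 + q^-1 = 1 -> 0 < al -> 0 < be -> al != be -> 0 <= C ->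
  {within `[0, 1], continuous w} ->
  (forall t : R, t \in `]0, 1[%R -> is_derive t 1 w (dw t)) ->
  (forall t : R, t \in `]0, 1[%R -> `|dw t| <= C * (t ^+ 2 * k t)) ->
  (forall t : R, t \in `]0, 1[%R -> 0 <= k t) ->
  (forall t : R, t \in `]0, 1[%R -> k t `^ q <= al `^ t * be `^ (1 - t)) ->
  `|w 1 - w 0| <=
    C * (((2 * p + 1) `^ p^-1)^-1 * log_mean al be `^ q^-1).
Proof.
move=> p1 pq al0 be0 albe C0 wc wd dwC k0 kq.
have p0 : 0 < p by lra.
have q0 := conjugate_exponent_gt0 _ _ _ p1 pq.
have L0 := log_mean_gt0 _ _ _ al0 be0 albe.
have lnD0 : ln al - ln be != 0 by rewrite subr_eq0 (inj_in_eq (@ln_inj R))// posrE.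
have LE : log_mean al be = (al - be) / (ln al - ln be).
  by rewrite /log_mean !gtr0_norm.
set L := log_mean al be in L0 LE *.
set P := (2 * p + 1) `^ p^-1.
have P0 : 0 < P by rewrite powR_gt0//; lra.
set La := L `^ q^-1.
have La0 : 0 < La by rewrite powR_gt0.
set M := C * (P^-1 * La).
(* [E t] is [al]^ t * be [^ (1 - t)], written as an exponential of an affine function to be
   differentiated. *)
pose E (t : R) := expR (t * ln al + (1 - t) * ln be).
pose c1 := M / p; pose c2 := M / (q * L * (ln al - ln be)).
pose Q (t : R) := c1 * t `^ (2 * p + 1) + c2 * E t.
pose dQ (t : R) := c1 * ((2 * p + 1) * t `^ (2 * p)) + c2 * ((ln al - ln be) * E t).
have Ed (t : R) : is_derive t 1 E ((ln al - ln be) * E t).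
  rewrite /E; apply: is_derive_eq.
  by rewrite /GRing.scale/=; ring.
(* The power contributes [M / p]. The exponential contributes [c2 * (al - be)], which is [M / q]
   because [al - be = L * (ln al - ln be)]. *)
have QE : Q 1 - Q 0 = M.
  rewrite /Q /E powR1 powR0 ?gt_eqF//; last by lra.
  rewrite !mul1r !mul0r subrr subr0 mul0r mul1r addr0 add0r !lnK//.
  rewrite mulr1 mulr0 add0r -addrA -mulrBr /c1 /c2.
  rewrite [in X in _ + X]LE.
  transitivity (M * (p^-1 + q^-1)); last by rewrite pq mulr1.
  by field; rewrite lnD0 gt_eqF// subr_eq0 albe gt_eqF.
rewrite -QE.
apply: (@norm_increment_le R 0 1 w Q dw dQ);
  [exact: ler01| | |exact: wc|].
- move=> t; rewrite in_itv/= => /andP[t0 t1].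
  rewrite /Q /dQ.
  have := @is_derive1_powR R (2 * p + 1) t t0; rewrite addrK => Hp.
  have := Ed t => HE.
  exact: is_derive_eq.
- move=> t t01; apply: le_trans (dwC _ t01) _.
  have t0 : 0 < t by move: t01; rewrite in_itv/= => /andP[].
  have := @conjugate_powR R (t ^+ 2 * P) (k t / La) p q.
  have -> : (t ^+ 2 * P) `^ p = t `^ (2 * p) * (2 * p + 1).
    rewrite powRM ?sqr_ge0 ?ltW// -powR_mulrn ?ltW// -powRrM.
    by rewrite /P -powRrM mulVf ?gt_eqF// powRr1//; lra.
  have -> : (k t / La) `^ q = k t `^ q / L.
    rewrite powRM ?k0 ?invr_ge0 ?ltW//; congr (_ * _).
    rewrite -powR_inv1 ?ltW// -powRrM mulN1r powRN.
    by rewrite -powRrM mulVf ?gt_eqF// powRr1 ?ltW.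
  have M0 : 0 <= M by rewrite mulr_ge0// mulr_ge0// ?invr_ge0 ltW.
  have tP0 : 0 <= t ^+ 2 * P by rewrite mulr_ge0 ?sqr_ge0 ?ltW.
  have kL0 : 0 <= k t / La by rewrite divr_ge0 ?k0 ?ltW.
  move=> /(_ tP0 kL0 p0 q0 pq) young.
  have -> : C * (t ^+ 2 * k t) = M * (t ^+ 2 * P * (k t / La)).
    by rewrite /M; field; rewrite !gt_eqF.
  have -> : dQ t = M * (t `^ (2 * p) * (2 * p + 1) / p + E t / L / q).
    by rewrite /dQ /c1 /c2; field; rewrite lnD0 !gt_eqF.
  apply: ler_wpM2l => //; apply: (le_trans young).
  rewrite lerD2l !ler_pM2r ?invr_gt0//.
  by rewrite (le_trans (kq _ t01))// /powR !gt_eqF// -expRD.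
- have cp : {within `[0, 1], continuous (fun t : R => t `^ (2 * p + 1))}.
    by apply: powR_within_continuous01; lra.
  have cE : continuous E.
    move=> t; apply: differentiable_continuous; apply/derivable1_diffP.
    by have [] := Ed t.
  move=> t; apply: cvgD.
    by apply: cvgM; [exact: cvg_cst|exact: cp].
  by apply: cvgM; [exact: cvg_cst|exact: (continuous_subspaceT cE)].
Qed.

(** * Geometric convexity along a segment and the estimate at one endpoint *)

Lemma weighted_AM_GM (R : realType) (y z t : R) :
  0 < y -> 0 < z -> 0 < t < 1 ->
  y `^ t * z `^ (1 - t) <= t * y + (1 - t) * z.
Proof.
move=> y0 z0 /andP[t0 t1].
have s0 : 0 < 1 - t by lra.
(* Young's inequality with the conjugate exponents [t^-1] and [(1 - t)^-1]. *)
have := @conjugate_powR R (y `^ t) (z `^ (1 - t)) t^-1 (1 - t)^-1.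
rewrite -!powRrM !divff ?gt_eqF// (powRr1 (ltW y0)) (powRr1 (ltW z0)) !invrK.
rewrite [y * t]mulrC [z * _]mulrC; apply; rewrite ?powR_ge0 ?invr_gt0//.
by rewrite subrKC.
Qed.

Lemma geometrically_convex_at_mean (R : realType) (a b y z t : R) (g : R -> R) :
  geometrically_convex `[a, b] g -> {in `[a, b]%R &, nonincreasing_fun g} ->
  y \in `[a, b]%R -> z \in `[a, b]%R -> 0 < t < 1 ->
  g (t * y + (1 - t) * z) <= g y `^ t * g z `^ (1 - t).
Proof.
move=> [_ pos _ gc] decr yab zab t01.
have t01' : 0 <= t <= 1 by move: t01 => /andP[]; lra.
apply: le_trans (gc _ _ _ yab zab t01').
have [y0 z0] : 0 < y /\ 0 < z by split; apply: pos.
have AG := weighted_AM_GM _ _ _ _ y0 z0 t01.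
have a0 : 0 < a.
  by apply: pos; move: yab; rewrite /= !in_itv/= => /andP[ay yb]; rewrite lexx (le_trans ay).
move: yab zab t01; rewrite !in_itv/= => /andP[ay yb] /andP[az zb] /andP[t0 t1].
(* Monotonicity is available only on [a, b], so both means must lie there: the arithmetic mean is at
   most [b], the geometric mean is at least [a], and [AG] gives the two remaining bounds. *)
have mb : t * y + (1 - t) * z <= b by nra.
have am : a <= y `^ t * z `^ (1 - t).
  have -> : a = a `^ t * a `^ (1 - t).
    by rewrite -powRD ?subrKC ?powRr1 ?ltW// gt_eqF// implybT.
  apply: ler_pM; rewrite ?powR_ge0// ge0_ler_powR// ?nnegrE; lra.
apply: decr => //; rewrite in_itv/=; apply/andP; split => //.
- exact: le_trans AG mb.
- exact: le_trans am AG.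
Qed.

Lemma increment_le_at_endpoint (R : realType) (a b p q x c : R) (F f : R -> R) :
  1 < p -> p^-1 + q^-1 = 1 ->
  geometrically_convex `[a, b] (fun y => `|f^`(2) y| `^ q) ->
  {in `[a, b]%R &, nonincreasing_fun (fun y => `|f^`(2) y| `^ q)} ->
  x \in `[a, b]%R -> c \in `[a, b]%R -> `|f^`(2) x| <> `|f^`(2) c| ->
  (forall s : R, s \in `[a, b]%R -> is_derive s 1 F (f s)) ->
  (forall s : R, s \in `[a, b]%R -> derivable f s 1) ->
  (forall s : R, s \in `[a, b]%R -> derivable f^`() s 1) ->
  `|F x - F c - (x - c) * f x + (x - c) ^+ 2 / 2 * (f^`()%classic) x| <=
  `|x - c| ^+ 3 / 2 * (((2 * p + 1) `^ p^-1)^-1 *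
     log_mean (`|(f^`(2)%classic) x| `^ q) (`|(f^`(2)%classic) c| `^ q) `^ q^-1).
Proof.
move=> p1 pq gc decr xab cab xc dF df df2.
have q0 := conjugate_exponent_gt0 _ _ _ p1 pq.
have [_ _ gpos _] := gc.
pose s (t : R) := t * x + (1 - t) * c.
pose W (y : R) := F y - F c - (y - c) * f y + (y - c) ^+ 2 / 2 * (f^`()%classic) y.
have sab (t : R) : t \in `[0, 1]%R -> s t \in `[a, b]%R by exact: convex_comb_itvcc.
(* The derivatives of [F] and of [(y - c) * f y] leave only [- (y - c) * f' y], which the derivative
   of the square cancels. *)
have dW y : y \in `[a, b]%R -> is_derive y 1 W ((y - c) ^+ 2 / 2 * (f^`(2)%classic) y).
  move=> yab.
  have dF1 := dF _ yab.
  have df1 : is_derive y 1 f ((f^`()%classic) y).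
    by rewrite derive1E; exact/derivableP/df.
  have df3 : is_derive y 1 (f^`()%classic) ((f^`(2)%classic) y).
    by rewrite derive1nS derive1n1 derive1E; exact/derivableP/df2.
  rewrite /W; apply: is_derive_eq.
  by rewrite /GRing.scale/=; field.
have ds (t : R) : is_derive t 1 s (x - c).
  rewrite /s; apply: is_derive_eq.
  by rewrite /GRing.scale/=; ring.
have dWs (t : R) : t \in `[0, 1]%R -> is_derive t 1 (W \o s)
    ((s t - c) ^+ 2 / 2 * (f^`(2)%classic) (s t) * (x - c)).
  by move=> t01; have := dW _ (sab _ t01) => dWst; apply: is_derive1_comp.
have -> : F x - F c - (x - c) * f x + (x - c) ^+ 2 / 2 * (f^`()%classic) x =
    (W \o s) 1 - (W \o s) 0.
  by rewrite /W /s /=; rewrite mul1r subrr !mul0r addr0 subr0 mul1r add0r; ring.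
have oc (t : R) : t \in `]0, 1[%R -> t \in `[0, 1]%R by exact: subset_itv_oo_cc.
have sE (t : R) : s t - c = t * (x - c) by rewrite /s; ring.
have gx : 0 < `|(f^`(2)%classic) x| `^ q by exact: gpos.
have gc0 : 0 < `|(f^`(2)%classic) c| `^ q by exact: gpos.
have gxc : `|(f^`(2)%classic) x| `^ q != `|(f^`(2)%classic) c| `^ q.
  by apply/eqP => /(powR_injective q0) E; apply: xc; apply: E; exact: normr_ge0.
have C0 : 0 <= `|x - c| ^+ 3 / 2 by rewrite divr_ge0// exprn_ge0.
have Wsc : {within `[0, 1], continuous (W \o s)}.
  by apply: derivable_within_continuous => t t01; have [] := dWs _ t01.
apply: (norm_increment_le_log_mean _ _ _ _ _ _ _ _
  (fun t => `|(f^`(2)%classic) (s t)|) p1 pq gx gc0 gxc C0 Wsc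
  (fun t t01 => dWs t (oc t t01))).
(* Two factors [x - c] come from the square and one from the chain rule, whence the cube. The
   absolute value covers both [c = a] and [c = b]. *)
- move=> t t01; rewrite sE !normrM normfV.
  have t0 : 0 <= t by move: t01; rewrite in_itv/= => /andP[/ltW].
  rewrite (ger0_norm t0) (ger0_norm (ler0n R 2)) le_eqVlt.
  by apply/orP; left; apply/eqP; field.
- by move=> t _; exact: normr_ge0.
- move=> t; rewrite in_itv/= => t01.
  exact: (geometrically_convex_at_mean _ _ _ _ _ _ _ gc decr).
Qed.

(** * The integral of f through an antiderivative *)

Lemma segment_interior_widen (R : realType) (I : set R) (a b : R) :
  is_interval I -> I° a -> I° b ->
  exists u v : R, [/\ u < a, b < v & `[u, v] `<=` I°].
Proof.
move=> hI ha hb.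
have ex_nbhs y : I° y -> exists2 e : R, 0 < e & forall z, `|y - z| < e -> I z.
  by move=> /nbhs_ballP[e e0 sub]; exists e => // z; exact: sub.
have [d d0 dI] := ex_nbhs _ ha.
have [e e0 eI] := ex_nbhs _ hb.
(* The open interval with margins [d / 2] and [e / 2] lies in [I], hence in its interior; the
   smaller margins fit a closed interval inside it. *)
exists (a - d / 3), (b + e / 3); split; [lra|lra|].
have sub : `](a - d / 2), (b + e / 2)[ `<=` I.
  move=> y; rewrite /= in_itv/= => /andP[ay yb].
  apply: (hI (a - d / 2) (b + e / 2)).
  - by apply: dI; rewrite subKr gtr0_norm; lra.
  - by apply: eI; rewrite opprD addNKr normrN gtr0_norm; lra.
  - by rewrite !ltW.
apply: subset_trans (_ : `](a - d / 2), (b + e / 2)[ `<=` _); last first.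
  by rewrite -open_subsetE//; exact: interval_open.
by move=> y; rewrite /= !in_itv/= => /andP[? ?]; apply/andP; split; lra.
Qed.

(** Starting the integral at [u < a] and keeping room up to [v > b] makes [F] differentiable from
    both sides even at [a] and [b]. *)
Lemma continuous_antiderivative (R : realType) (f : R -> R) (u v a b : R) :
  u < a -> a < b -> b < v ->
  (forall y : R, y \in `[u, v]%R -> {for y, continuous f}) ->
  exists2 F : R -> R, (forall y : R, y \in `[a, b]%R -> is_derive y 1 F (f y)) &
    \int[@lebesgue_measure R]_(t in `[a, b]) f t = F b - F a.
Proof.
move=> ua ab bv cf.
have abuv y : y \in `[a, b]%R -> y \in `[u, v]%R.
  by rewrite !in_itv/= => /andP[? ?]; apply/andP; split; lra.
have cfuv : {within `[u, v], continuous f}.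
  by apply: continuous_in_subspaceT => y /[!inE]; exact: cf.
have intf : (@lebesgue_measure R).-integrable `[u, v] (EFin \o f).
  by apply: continuous_compact_integrable => //; exact: segment_compact.
pose F y := \int[@lebesgue_measure R]_(t in `[u, y]) f t.
have dF y : y \in `[a, b]%R -> is_derive y 1 F (f y).
  move=> yab; have := yab; rewrite in_itv/= => /andP[ay yb].
  have [dFy F'y] := @continuous_FTC1_closed R f u y v (le_lt_trans yb bv) intf
    (lt_le_trans ua ay) (cf _ (abuv _ yab)).
  by split; [exact: dFy|rewrite -derive1E].
exists F => //.
have cF y : y \in `[a, b]%R -> {for y, continuous F}.
  by move=> /dF[dFy _]; exact/differentiable_continuous/derivable1_diffP.
rewrite /Rintegral (@continuous_FTC2 _ f F a b)//.
- by apply: continuous_in_subspaceT => y /[!inE] /abuv; exact: cf.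
- split.
  + by move=> y /subset_itv_oo_cc /dF[].
  + by apply: cvg_at_right_filter; apply: cF; rewrite in_itv/= lexx ltW.
  + by apply: cvg_at_left_filter; apply: cF; rewrite in_itv/= lexx ltW.
- by move=> y /subset_itv_oo_cc /dF [_ <-]; rewrite derive1E.
Qed.

(** * Combining the estimates at the two endpoints *)

Lemma norm_mean_le (R : realType) (a b x Fa Fb Fx y d P La Lb : R) :
  a < b ->
  `|Fx - Fa - (x - a) * y + (x - a) ^+ 2 / 2 * d| <= (x - a) ^+ 3 / 2 * (P * La) ->
  `|Fx - Fb - (x - b) * y + (x - b) ^+ 2 / 2 * d| <= (b - x) ^+ 3 / 2 * (P * Lb) ->
  `|(b - a)^-1 * (Fb - Fa) - y + (x - (a + b) / 2) * d| <=
  P * ((x - a) ^+ 3 / (2 * (b - a)) * La + (b - x) ^+ 3 / (2 * (b - a)) * Lb).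
Proof.
move=> ab; set A := (X in `|X| <= _) => hA; set B := (X in `|X| <= _) => hB.
have ba0 : 0 < b - a by rewrite subr_gt0.
have ban0 : b - a != 0 by rewrite gt_eqF.
(* [Fx] cancels in [A - B], and the difference of the two squares is [(b - a) * (2 * x - a - b)],
   which produces the midpoint. *)
have -> : (b - a)^-1 * (Fb - Fa) - y + (x - (a + b) / 2) * d = (A - B) / (b - a).
  by rewrite /A /B; field.
rewrite normrM normfV (gtr0_norm ba0) ler_pdivrMr//.
apply: le_trans (ler_normB _ _) _; apply: le_trans (lerD hA hB) _.
by rewrite le_eqVlt; apply/orP; left; apply/eqP; field.
Qed.

Theorem theorem2 (R : realType) (I : set R) (f : R -> R) (a b p q x : R)
  (hI : is_interval I) (hIpos : forall y : R, I y -> 0 < y)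
  (hfpos : forall y : R, I° y -> 0 < f y)
  (hf1 : forall y : R, I° y -> derivable f y 1)
  (hf2 : forall y : R, I° y -> derivable f^`() y 1)
  (ha : I° a) (hb : I° b) (hab : a < b)
  (hL1 : (@lebesgue_measure R).-integrable `[a, b] (EFin \o f^`(2)))
  (hp : 1 < p) (hpq : p^-1 + q^-1 = 1)
  (hgc : geometrically_convex `[a, b] (fun y => `|f^`(2) y| `^ q))
  (hdecr : {in `[a, b]%R &, nonincreasing_fun (fun y => `|f^`(2) y| `^ q)})
  (hx : x \in `[a, b]%R)
  (hxa : `|f^`(2) x| <> `|f^`(2) a|)
  (hxb : `|f^`(2) x| <> `|f^`(2) b|) :
  `| (b - a)^-1 * (\int[@lebesgue_measure R]_(u in `[a, b]) f u)
     - f x + (x - (a + b) / 2) * (f^`()%classic) x |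
  <= ((2 * p + 1) `^ p^-1)^-1 *
     ((x - a) ^+ 3 / (2 * (b - a)) *
        log_mean (`|(f^`(2)%classic) x| `^ q) (`|(f^`(2)%classic) a| `^ q) `^ q^-1
      + (b - x) ^+ 3 / (2 * (b - a)) *
        log_mean (`|(f^`(2)%classic) x| `^ q) (`|(f^`(2)%classic) b| `^ q) `^ q^-1).
Proof.
(* The margin around [a, b] stays where [f] is differentiable, hence continuous. *)
have [u [v [ua bv uvI]]] := segment_interior_widen _ _ _ _ hI ha hb.
have abI y : y \in `[a, b]%R -> I° y.
  move=> /itvP yab; apply: uvI; rewrite /= in_itv/=.
  by rewrite (le_trans (ltW ua)) ?(le_trans _ (ltW bv)) ?yab.
have cf y : y \in `[u, v]%R -> {for y, continuous f}.
  by move=> /uvI /hf1 /derivable1_diffP /differentiable_continuous.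
have [F dF ->] := continuous_antiderivative _ _ _ _ _ _ ua hab bv cf.
have bound c (cab : c \in `[a, b]%R) (xc : `|f^`(2) x| <> `|f^`(2) c|) :=
  increment_le_at_endpoint _ _ _ _ _ _ _ F f hp hpq hgc hdecr hx
    cab xc dF (fun s sab => hf1 _ (abI s sab)) (fun s sab => hf2 _ (abI s sab)).
have aab : a \in `[a, b]%R by rewrite in_itv/= lexx ltW.
have bab : b \in `[a, b]%R by rewrite in_itv/= lexx ltW.
have := bound _ aab hxa; have := bound _ bab hxb.
move: (hx); rewrite in_itv/= => /andP[ax xb].
have xa0 : 0 <= x - a by rewrite subr_ge0.
have bx0 : 0 <= b - x by rewrite subr_ge0.
rewrite (distrC x b) (ger0_norm xa0) (ger0_norm bx0).
by move=> hB hA; exact: (norm_mean_le _ _ _ _ _ _ _ _ _ _ _ _ hab hA hB).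
Qed.
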